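(* Let $T, D, N \ge 1$ be integers, let $\beta \ge 0$ be a hyperparameter, and for each $t = 1,\dots,T$ let $Z^{\mathrm{mtl}}_t, Z^{\mathrm{ind}}_t \in \mathbb{R}^{D\times N}$ be real matrices. For each $t$ let $Z^{\mathrm{ind}}_t (Z^{\mathrm{mtl}}_t)^{\mathsf T} = U_t S_t V_t^{\mathsf T}$ be a singular value decomposition and put $W_t^{\mathrm{orth}} = U_t V_t^{\mathsf T}$. For $W \in \mathbb{R}^{D\times D}$ define $$L_t(W) = \|W Z^{\mathrm{mtl}}_t - Z^{\mathrm{ind}}_t\|_F^2 + \beta \|W - W_t^{\mathrm{orth}}\|_F^2 , \qquad t=1,\dots,T.$$ Then for any preference vector $\mathbf{p} = (p_1,\dots,p_T)$, i.e. $p_t \ge 0$ for all $t$ and $\sum_{t=1}^T p_t = 1$, the unique Pareto-optimal solution $W_{\mathbf{p}}$ (for the preference $\mathbf{p}$) to the multi-objective problem $$\min_{W} \{L_1(W),\dots,L_T(W)\}$$ has a closed-form expression given by $$W_{\mathbf{p}} = \left( \sum_{t=1}^{T} p_t \left( Z^{\mathrm{ind}}_t (Z^{\mathrm{mtl}}_t)^{\mathsf T} + \beta W^{\mathrm{orth}}_t \right) \right) \left( \sum_{t=1}^{T} p_t \left( Z^{\mathrm{mtl}}_t (Z^{\mathrm{mtl}}_t)^{\mathsf T} + \beta I \right) \right)^{-1}.$$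
   Context: $\|\cdot\|_F$ is the Frobenius norm, $I$ is the $D\times D$ identity matrix, and $A^{\mathsf T}$ denotes the transpose. In the singular value decomposition, $U_t, V_t \in \mathbb{R}^{D\times D}$ are orthogonal and $S_t$ is diagonal with nonnegative entries. A solution $W^*$ is Pareto-optimal for $\min_W \{L_1(W),\dots,L_T(W)\}$ if it is not possible to improve (decrease) one of the objectives $L_t$ without degrading (increasing) at least one other. The Pareto-optimal solution for a preference vector $\mathbf{p}$ is the one obtained by linear scalarization: $W_{\mathbf{p}}$ is the unique minimizer over $W \in \mathbb{R}^{D\times D}$ of the weighted objective $\sum_{t=1}^T p_t L_t(W)$, and the statement asserts that this minimizer is Pareto-optimal for the multi-objective problem.
   Formalization: For β = 0 the matrix being inverted, the weighted sum of Z_t^mtl (Z_t^mtl)^T, is assumed invertible; otherwise (e.g. Z^mtl = 0) the inverse is undefined and the minimizer is not unique. For β > 0 its invertibility is proved. *)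

(* Defs.v *)
From mathcomp Require Export all_boot all_order all_algebra.
From mathcomp Require Export reals.

Set Implicit Arguments.
Unset Strict Implicit.
Unset Printing Implicit Defensive.

Import Order.TTheory GRing.Theory Num.Theory.
Local Open Scope ring_scope.

Definition frobenius_norm (R : realType) (m n : nat) (A : 'M[R]_(m, n)) : R :=
  Num.sqrt (\sum_i \sum_j A i j ^+ 2).

Definition orthogonal_mx (R : realType) (n : nat) (Q : 'M[R]_n) : Prop :=
  Q *m Q^T = 1%:M /\ Q^T *m Q = 1%:M.

(* The diagonal entries of S need not be sorted. *)
Definition is_svd (R : realType) (n : nat) (A U S V : 'M[R]_n) : Prop :=
  [/\ orthogonal_mx U, orthogonal_mx V, is_diag_mx S,
      forall i, 0 <= S i i & A = U *m S *m V^T].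

Definition preference_vector (R : realType) (T : nat) (p : 'I_T -> R) : Prop :=
  (forall t, 0 <= p t) /\ \sum_t p t = 1.

Definition minimizer (R : realType) (X : Type) (f : X -> R) (x : X) : Prop :=
  forall y, f x <= f y.

Definition pareto_optimal (R : realType) (X : Type) (T : nat)
    (L : 'I_T -> X -> R) (x : X) : Prop :=
  forall (y : X) (s : 'I_T), L s y < L s x -> exists t : 'I_T, L t x < L t y.

Definition weighted_objective (R : realType) (X : Type) (T : nat)
    (L : 'I_T -> X -> R) (p : 'I_T -> R) (x : X) : R :=
  \sum_t p t * L t x.

(* Linear scalarization: [unique P x] says that P x holds and that every y
   satisfying P equals x. *)
Definition unique_pareto_solution (R : realType) (X : Type) (T : nat)
    (L : 'I_T -> X -> R) (p : 'I_T -> R) (x : X) : Prop :=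
  unique (minimizer (weighted_objective L p)) x /\ pareto_optimal L x.

Definition align_loss (R : realType) (D N : nat) (beta : R)
    (Zmtl Zind : 'M[R]_(D, N)) (Worth W : 'M[R]_D) : R :=
  frobenius_norm (W *m Zmtl - Zind) ^+ 2
  + beta * frobenius_norm (W - Worth) ^+ 2.

Definition weighted_cross (R : realType) (T D N : nat) (beta : R)
    (p : 'I_T -> R) (Zmtl Zind : 'I_T -> 'M[R]_(D, N))
    (Worth : 'I_T -> 'M[R]_D) : 'M[R]_D :=
  \sum_t p t *: (Zind t *m (Zmtl t)^T + beta *: Worth t).

Definition weighted_gram (R : realType) (T D N : nat) (beta : R)
    (p : 'I_T -> R) (Zmtl : 'I_T -> 'M[R]_(D, N)) : 'M[R]_D :=
  \sum_t p t *: (Zmtl t *m (Zmtl t)^T + beta *: 1%:M).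

(* Main.v *)
(* With G the weighted Gram matrix and C the weighted cross term, the scalarized
   objective F is quadratic:
     F (W + H) = F W + 2 tr ((W G - C) H^T) + tr (H G H^T),
   where tr (H G H^T) = \sum_t p_t (|H Z_t|^2 + beta |H|^2) is nonnegative and
   vanishes only if H G = 0.  When G is invertible, the stationary point
   W = C G^-1 is therefore the strict global minimizer.  A point dominating a
   unique minimizer of F would itself minimize F, hence Pareto optimality even
   when some weights vanish. *)

Require Import Defs.
From mathcomp Require Import ring.

Set Implicit Arguments.
Unset Strict Implicit.
Unset Printing Implicit Defensive.

Import Order.TTheory GRing.Theory Num.Theory.
Local Open Scope ring_scope.

Section Frobenius.
Variable R : realType.

Lemma sqr_frobenius_norm m n (A : 'M[R]_(m, n)) :
  frobenius_norm A ^+ 2 = \tr (A *m A^T).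
Proof.
rewrite sqr_sqrtr; last by apply: sumr_ge0 => i _; apply: sumr_ge0 => j _; exact: sqr_ge0.
by apply: eq_bigr => i _; rewrite mxE; apply: eq_bigr => j _; rewrite mxE expr2.
Qed.

Lemma frobenius_norm_eq0 m n (A : 'M[R]_(m, n)) :
  (frobenius_norm A == 0) = (A == 0).
Proof.
have ge0 i : 0 <= \sum_j A i j ^+ 2 by apply: sumr_ge0 => j _; exact: sqr_ge0.
apply/idP/eqP => [|->]; last first.
  rewrite /frobenius_norm big1 ?sqrtr0// => i _.
  by rewrite big1// => j _; rewrite mxE expr0n.
rewrite -sqrf_eq0 sqr_sqrtr ?sumr_ge0// psumr_eq0// => /allP A0.
apply/matrixP => i j; rewrite mxE; have := A0 i (mem_index_enum i).
rewrite psumr_eq0/= => [/allP/(_ j (mem_index_enum j))|k _]; last exact: sqr_ge0.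
by rewrite sqrf_eq0 => /eqP.
Qed.

Lemma sqr_frobenius_normD m n (A B : 'M[R]_(m, n)) :
  frobenius_norm (A + B) ^+ 2
  = frobenius_norm A ^+ 2 + \tr (A *m B^T) *+ 2 + frobenius_norm B ^+ 2.
Proof.
rewrite !sqr_frobenius_norm linearD/= mulmxDl !mulmxDr !mxtraceD.
(* The trace is invariant under transposition, so the two cross terms coincide. *)
rewrite -(mxtrace_tr (B *m A^T)) trmx_mul trmxK; ring.
Qed.

End Frobenius.

Lemma unique_minimizer_pareto_optimal (R : realType) (X : Type) (T : nat)
    (L : 'I_T -> X -> R) (p : 'I_T -> R) (x : X) :
  (forall t, 0 <= p t) -> unique (minimizer (weighted_objective L p)) x ->
  pareto_optimal L x.
Proof.
move=> p_ge0 [x_min x_uniq] y s Lsyx.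
have [/existsP //|] := boolP [exists t, L t x < L t y].
rewrite negb_exists => /forallP Lyx.
have yE : x = y.
  apply: x_uniq => z; apply: le_trans (x_min z).
  by apply: ler_sum => t _; rewrite ler_wpM2l// leNgt.
by rewrite yE ltxx in Lsyx.
Qed.

Section WeightedLoss.
Variables (R : realType) (T D N : nat) (beta : R) (p : 'I_T -> R).
Variables (Zmtl Zind : 'I_T -> 'M[R]_(D, N)) (Worth : 'I_T -> 'M[R]_D).

Let G := weighted_gram beta p Zmtl.
Let C := weighted_cross beta p Zmtl Zind Worth.
Let F := weighted_objective
  (fun t => align_loss beta (Zmtl t) (Zind t) (Worth t)) p.

Lemma mxtrace_weighted_gram m (H : 'M[R]_(m, D)) :
  \tr (H *m G *m H^T) = \sum_t p t *
    (frobenius_norm (H *m Zmtl t) ^+ 2 + beta * frobenius_norm H ^+ 2).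
Proof.
rewrite /G /weighted_gram mulmx_sumr mulmx_suml raddf_sum/=.
apply: eq_bigr => t _; rewrite -scalemxAr -scalemxAl mxtraceZ; congr (_ * _).
rewrite !sqr_frobenius_norm mulmxDr mulmxDl mxtraceD trmx_mul !mulmxA.
by rewrite -scalemxAr -scalemxAl mxtraceZ mulmx1.
Qed.

Lemma weighted_objectiveD (W H : 'M[R]_D) :
  F (W + H) = F W + \tr ((W *m G - C) *m H^T) *+ 2 + \tr (H *m G *m H^T).
Proof.
rewrite mxtrace_weighted_gram /F /weighted_objective /G /C.
rewrite /weighted_gram /weighted_cross mulmx_sumr -sumrB mulmx_suml raddf_sum/=.
rewrite -sumrMnl -!big_split/=; apply: eq_bigr => t _.
rewrite -scalemxAr -scalerBr -scalemxAl mxtraceZ /align_loss.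
rewrite mulmxDl [_ - Zind t]addrAC [_ - Worth t]addrAC.
rewrite (sqr_frobenius_normD (_ - Zind t)) (sqr_frobenius_normD (_ - Worth t)).
rewrite mulmxDr -scalemxAr mulmx1 trmx_mul.
(* Both sides are half the gradient at [W] of the [t]-th loss. *)
have -> : W *m (Zmtl t *m (Zmtl t)^T) + beta *: W
    - (Zind t *m (Zmtl t)^T + beta *: Worth t)
    = (W *m Zmtl t - Zind t) *m (Zmtl t)^T + beta *: (W - Worth t).
  by rewrite mulmxBl mulmxA scalerBr opprD addrACA.
rewrite [in RHS]mulmxDl mxtraceD -scalemxAl mxtraceZ !mulmxA; ring.
Qed.

Hypotheses (beta_ge0 : 0 <= beta) (p_ge0 : forall t, 0 <= p t).

Let summand_ge0 m (H : 'M[R]_(m, D)) t : 0 <= p t *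
  (frobenius_norm (H *m Zmtl t) ^+ 2 + beta * frobenius_norm H ^+ 2).
Proof. by rewrite mulr_ge0// addr_ge0 ?sqr_ge0// mulr_ge0 ?sqr_ge0. Qed.

Lemma mxtrace_weighted_gram_ge0 m (H : 'M[R]_(m, D)) :
  0 <= \tr (H *m G *m H^T).
Proof. by rewrite mxtrace_weighted_gram sumr_ge0. Qed.

(** A vanishing sum of nonnegative terms vanishes termwise: for each [t], either [p t = 0], or
    [H *m Zmtl t = 0] and [beta *: H = 0]. Either way the [t]-th term of [H *m G] is zero. *)
Lemma mxtrace_weighted_gram_eq0 m (H : 'M[R]_(m, D)) :
  \tr (H *m G *m H^T) = 0 -> H *m G = 0.
Proof.
rewrite mxtrace_weighted_gram => /eqP; rewrite psumr_eq0// => /allP H0.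
rewrite /G /weighted_gram mulmx_sumr big1// => t _.
have := H0 t (mem_index_enum t); rewrite mulf_eq0 => /orP[/eqP->|].
  by rewrite scale0r mulmx0.
rewrite paddr_eq0 ?sqr_ge0 ?(mulr_ge0 beta_ge0) ?sqr_ge0// sqrf_eq0 frobenius_norm_eq0.
rewrite mulf_eq0 sqrf_eq0 frobenius_norm_eq0 => /andP[/eqP HZ0 bH0].
rewrite -scalemxAr mulmxDr mulmxA HZ0 mul0mx add0r -scalemxAr mulmx1.
by case/orP: bH0 => /eqP->; rewrite ?scale0r ?scaler0.
Qed.

Lemma weighted_gram_unitmx : \sum_t p t = 1 -> 0 < beta -> G \in unitmx.
Proof.
move=> p1 beta_gt0; rewrite -row_free_unit -kermx_eq0 -frobenius_norm_eq0.
set K := kermx G; have : \tr (K *m G *m K^T) = 0 by rewrite mulmx_ker mul0mx mxtrace0.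
rewrite mxtrace_weighted_gram.
(* As the weights sum to 1, the ridge terms add up to [beta] times the squared norm of [K], which
   forces the left kernel of [G] to be trivial. *)
under eq_bigr do rewrite mulrDr; rewrite big_split/= -mulr_suml p1 mul1r.
move/eqP; rewrite paddr_eq0.
- by rewrite mulf_eq0 (gt_eqF beta_gt0)/= sqrf_eq0 => /andP[].
- by apply: sumr_ge0 => t _; rewrite mulr_ge0 ?sqr_ge0.
- by rewrite mulr_ge0 ?sqr_ge0.
Qed.

Lemma unique_minimizer_weighted_objective :
  G \in unitmx -> unique (minimizer F) (C *m invmx G).
Proof.
move=> G_unit; set W := C *m invmx G.
(* Expansion around [W]: the linear term drops out because [W *m G = C]. *)
have FE Y : F Y = F W + \tr ((Y - W) *m G *m (Y - W)^T).
  rewrite -{1}(subrK W Y) addrC weighted_objectiveD.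
  by rewrite mulmxKV// subrr mul0mx mxtrace0 mul0rn addr0.
split=> [Y|Y Y_min]; first by rewrite (FE Y) lerDl mxtrace_weighted_gram_ge0.
(* Minimality of [Y] gives [F Y <= F W], so the quadratic term is also at most 0. *)
have /mxtrace_weighted_gram_eq0 HG0 : \tr ((Y - W) *m G *m (Y - W)^T) = 0.
  apply/eqP; rewrite eq_le mxtrace_weighted_gram_ge0 andbT.
  by rewrite -(gerDl (F W)) -FE Y_min.
by apply/esym/subr0_eq; rewrite -(mulmxK G_unit (Y - W)) HG0 mul0mx.
Qed.

End WeightedLoss.

(* [invmx] is total, so the inverse is meaningful only for a unit matrix.
   For beta = 0 the weighted Gram matrix can be singular (e.g. Zmtl = 0), and
   then neither the closed form nor the unique minimizer exists; the formula's
   presupposition is assumed in that case only.  For beta > 0 invertibility is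
   part of the conclusion. *)
Theorem proposition1 (R : realType) (T D N : nat)
    (T_ge1 : (1 <= T)%N) (D_ge1 : (1 <= D)%N) (N_ge1 : (1 <= N)%N)
    (beta : R) (beta_ge0 : 0 <= beta)
    (Zmtl Zind : 'I_T -> 'M[R]_(D, N))
    (U S V : 'I_T -> 'M[R]_D)
    (svd : forall t, is_svd (Zind t *m (Zmtl t)^T) (U t) (S t) (V t))
    (p : 'I_T -> R) (p_pref : preference_vector p)
    (inv_exists : beta = 0 -> weighted_gram beta p Zmtl \in unitmx) :
  let Worth := fun t => U t *m (V t)^T in
  let L := fun t => align_loss beta (Zmtl t) (Zind t) (Worth t) in
  weighted_gram beta p Zmtl \in unitmx /\
  unique_pareto_solution L p
    (weighted_cross beta p Zmtl Zind Worth *m invmx (weighted_gram beta p Zmtl)).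
Proof.
move=> Worth L; have [p_ge0 p1] := p_pref.
have G_unit : weighted_gram beta p Zmtl \in unitmx.
  have := beta_ge0; rewrite le_eqVlt => /predU1P[/esym/inv_exists//|].
  exact: weighted_gram_unitmx.
have W_min := unique_minimizer_weighted_objective Zind Worth beta_ge0 p_ge0 G_unit.
by split=> //; split=> //; exact: unique_minimizer_pareto_optimal W_min.
Qed.
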